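(* Let $G$ be a locally compact group, $H$ a compact subgroup of $G$ with left Haar measure $dh$, and $L$ a closed subgroup of $H$ with left Haar measure $dl$. Let $\sigma$ be an $L$-invariant Radon measure on $G/L$ and let $\eta$ be the $H$-invariant Radon measure on $H/L$ with $\eta(H/L)=1$. Then the Radon transform $R_{L,H}$, defined by $$R_{L,H}f(xH)=\int_{H/L} f(xhL)\,d\eta(hL)\qquad (x\in G),$$ is a bijective linear operator from $C_c(G/L:H)$ to $C_c(G/H)$. Further, $(R_{L,H}f)_{\pi_{L,H}}=f$ for all $f\in C_c(G/L:H)$.
   Context: Locally compact groups are Hausdorff. $C_c(X)$ denotes the space of continuous complex-valued functions with compact support on $X$. For a closed subgroup $L$ of $H$, $$C_c(G/L:H):=\{f\in C_c(G/L) : f(xhL)=f(xL)\ \text{for all } x\in G,\ h\in H\}.$$ The map $\pi_{L,H}:G/L\to G/H$ is given by $\pi_{L,H}(xL)=xH$, and for a function $\varphi$ on $G/H$ we write $\varphi_{\pi_{L,H}}:=\varphi\circ\pi_{L,H}$. *)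

(* Defs.v *)
From HB Require Import structures.
From mathcomp Require Import all_boot all_order all_algebra.
From mathcomp Require Import all_classical all_reals all_analysis.
From mathcomp Require Import complex.
Import GRing.Theory numFieldNormedType.Exports.

Set Implicit Arguments.
Unset Strict Implicit.
Unset Printing Implicit Defensive.

Local Open Scope ring_scope.
Local Open Scope classical_set_scope.
Local Open Scope quotient_scope.
Local Open Scope group_scope.

HB.mixin Record isTopologicalGroup G of PointedTopological G & Group G := {
  mulg_continuous : continuous (fun z : G * G => z.1 * z.2);
  invg_continuous : continuous (fun x : G => x^-1)
}.

(* Only pointed types carry sigma-algebras in the library, hence the base
   point, which plays no role: every group can be pointed by 1. *)
#[short(type="topGroupType")]
HB.structure Definition TopologicalGroup :=
  {G of PointedTopological G & Group G & isTopologicalGroup G}.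

Section subgroup.
Context {G : topGroupType}.

Record subgroup (H : groupClosed G) : Type :=
  Subgroup { subgroup_val :> G; subgroup_valP : subgroup_val \in H }.

Variable H : groupClosed G.

Lemma groupClosed_closed : group_closed (H : {pred G}).
Proof.
split; first exact: gpred1.
by move=> x y xH yH; rewrite gpredM// gpredVr.
Qed.

HB.instance Definition _ := [isSub for @subgroup_val H].
HB.instance Definition _ := [Choice of subgroup H by <:].
HB.instance Definition _ := SubChoice_isSubGroup.Build G (mem H)
  (subgroup H) groupClosed_closed.
HB.instance Definition _ := isPointed.Build (subgroup H) 1.
HB.instance Definition _ :=
  Topological.copy (subgroup H) (initial_topology (@subgroup_val H)).

Lemma subgroup_val_continuous : continuous (@subgroup_val H).
Proof. exact: initial_continuous. Qed.

Lemma continuous_subgroup (T : topologicalType) (f : T -> subgroup H) :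
  continuous (fun t => subgroup_val (f t)) -> continuous f.
Proof.
move=> /continuousP cf; apply/continuousP => _ [B oB <-].
exact: (cf B oB).
Qed.

Lemma subgroup_mulg_continuous :
  continuous (fun z : subgroup H * subgroup H => z.1 * z.2).
Proof.
apply: continuous_subgroup => z.
apply: (@continuous_comp _ _ _
  (fun z : subgroup H * subgroup H => (z.1 : G, z.2 : G))
  (fun z : G * G => z.1 * z.2)); last exact: mulg_continuous.
apply: cvg_pair => /=.
  by apply: continuous_comp; [exact: cvg_fst|exact: subgroup_val_continuous].
by apply: continuous_comp; [exact: cvg_snd|exact: subgroup_val_continuous].
Qed.

Lemma subgroup_invg_continuous : continuous (fun x : subgroup H => x^-1).
Proof.
apply: continuous_subgroup => x.
apply: (@continuous_comp _ _ _ (@subgroup_val H) (fun y : G => y^-1)).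
  exact: subgroup_val_continuous.
exact: invg_continuous.
Qed.

HB.instance Definition _ := isTopologicalGroup.Build (subgroup H)
  subgroup_mulg_continuous subgroup_invg_continuous.

End subgroup.

(* A subgroup L of G traced on a subgroup H of G, as a subgroup of the group
   [subgroup H]; this is L itself when L is included in H, so that H/L is
   [homspace (trace_subgroup H L)]. *)
Definition trace_subgroup (G : topGroupType) (H L : groupClosed G) :
  {pred subgroup H} := [pred h | subgroup_val h \in L].
Arguments trace_subgroup {G} H L.

Section trace_subgroup.
Context {G : topGroupType} (H L : groupClosed G).

Lemma trace_mulg_closed : mulg_closed (trace_subgroup H L).
Proof. by move=> x y xL yL; rewrite inE/= gpredM. Qed.

Lemma trace_1 : 1 \in trace_subgroup H L.
Proof. by rewrite inE gpred1. Qed.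

Lemma trace_invg_closed : invg_closed (trace_subgroup H L).
Proof. by move=> x xL; rewrite inE/= gpredVr. Qed.

HB.instance Definition _ := isMulClosed.Build _ (trace_subgroup H L)
  trace_mulg_closed.
HB.instance Definition _ := isMul1Closed.Build _ (trace_subgroup H L) trace_1.
HB.instance Definition _ := isInvClosed.Build _ (trace_subgroup H L)
  trace_invg_closed.
End trace_subgroup.

Section homspace.
Context {G : topGroupType} (H : groupClosed G).

Definition lcoset_rel : rel G := fun x y => x^-1 * y \in H.

Lemma lcoset_rel_refl : reflexive lcoset_rel.
Proof. by move=> x; rewrite /lcoset_rel mulVg gpred1. Qed.

Lemma lcoset_rel_sym : symmetric lcoset_rel.
Proof.
by move=> x y; rewrite /lcoset_rel -[RHS]gpredV invgM invgK.
Qed.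

Lemma lcoset_rel_trans : transitive lcoset_rel.
Proof.
move=> y x z xy yz; rewrite /lcoset_rel -[z](mulVKg y) mulgA.
exact: gpredM.
Qed.

Canonical lcoset_equiv :=
  EquivRel lcoset_rel lcoset_rel_refl lcoset_rel_sym lcoset_rel_trans.

Definition homspace : Type := quotient_topology {eq_quot lcoset_equiv}.

HB.instance Definition _ := Quotient.copy homspace {eq_quot lcoset_equiv}.
HB.instance Definition _ := PointedTopological.copy homspace
  (quotient_topology {eq_quot lcoset_equiv}).

Definition lcoset (x : G) : homspace := \pi x.

Definition ltrans (x : G) (q : homspace) : homspace := lcoset (x * repr q).

Lemma lcosetP (x y : G) : lcoset x = lcoset y <-> x^-1 * y \in H.
Proof.
by split=> [|] h; apply/(@eqmodP G lcoset_equiv x y).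
Qed.

Lemma lcoset_repr (q : homspace) : lcoset (repr q) = q.
Proof. exact: reprK. Qed.

Lemma ltransE (x y : G) : ltrans x (lcoset y) = lcoset (x * y).
Proof.
apply/lcosetP; rewrite invgM -mulgA mulKg.
by apply/lcosetP; exact: lcoset_repr.
Qed.
End homspace.

Section homspace_maps.
Context {G : topGroupType} (H L : groupClosed G).

Definition coset_proj (q : homspace L) : homspace H := lcoset H (repr q).

Lemma coset_projE (x : G) : {subset L <= H} ->
  coset_proj (lcoset L x) = lcoset H x.
Proof.
move=> LH; apply/lcosetP; apply: LH.
by apply/lcosetP; exact: lcoset_repr.
Qed.

Definition coset_incl (q : homspace (trace_subgroup H L)) : homspace L :=
  lcoset L (subgroup_val (repr q)).

Lemma coset_inclE (h : subgroup H) :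
  coset_incl (lcoset (trace_subgroup H L) h) = lcoset L (subgroup_val h).
Proof.
apply/lcosetP; have /lcosetP := lcoset_repr (lcoset (trace_subgroup H L) h).
by rewrite inE.
Qed.
End homspace_maps.

Arguments coset_proj {G} H L.

Notation borel T := (g_sigma_algebraType (@open T)).

Section measures.
Context {R : realType}.
Local Open Scope ereal_scope.

Definition radon_measure (X : ptopologicalType)
    (mu : {measure set (borel X) -> \bar R}) : Prop :=
  [/\ forall K : set X, compact K -> mu K < +oo,
      forall A : set (borel X), measurable A ->
        mu A = ereal_inf [set mu U | U in [set U : set X | open U /\ A `<=` U]]
    & forall U : set X, open U ->
        mu U = ereal_sup
          [set mu K | K in [set K : set X | compact K /\ K `<=` U]]].

Definition left_haar_measure (G : topGroupType)
    (mu : {measure set (borel G) -> \bar R}) : Prop :=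
  [/\ radon_measure mu, mu setT != 0 &
      forall (x : G) (A : set (borel G)), measurable A ->
        mu [set x * y | y in A]%g = mu A].

Definition translation_invariant (G : topGroupType) (M : groupClosed G)
    (S : {pred G}) (mu : {measure set (borel (homspace M)) -> \bar R}) : Prop :=
  forall x, x \in S -> forall A : set (borel (homspace M)), measurable A ->
    mu [set ltrans x q | q in A] = mu A.

End measures.

Section functions.
Context {R : realType}.
Local Open Scope complex_scope.

(* The topology of R[i] is the one of its modulus, found on R[i]^o. *)
Definition Cc (X : topologicalType) : set (X -> R[i]) :=
  [set f | continuous (f : X -> R[i]^o) /\
           compact (closure [set x | f x != 0%R])].

Definition Cc_inv (G : topGroupType) (L H : groupClosed G) :
    set (homspace L -> R[i]) :=
  [set f | Cc f /\
           forall x h, h \in H -> f (lcoset L (x * h)) = f (lcoset L x)].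

Definition cintegral d (T : measurableType d)
    (mu : {measure set T -> \bar R}) (f : T -> R[i]) : R[i] :=
  (\int[mu]_t complex.Re (f t))%R +i* (\int[mu]_t complex.Im (f t))%R.

(* For q = hL in H/L, the integrand below is f(xhL); see [ltransE] and
   [coset_inclE]. *)
Definition fiber_integral (G : topGroupType) (H L : groupClosed G)
    (eta : {measure set (borel (homspace (trace_subgroup H L))) -> \bar R})
    (f : homspace L -> R[i]) (x : G) : R[i] :=
  cintegral eta (fun q => f (ltrans x (coset_incl q))).

(* The integral does not depend on the representative of p, when eta is
   invariant under the translations of H/L by H. *)
Definition radon_transform (G : topGroupType) (H L : groupClosed G)
    (eta : {measure set (borel (homspace (trace_subgroup H L))) -> \bar R})
    (f : homspace L -> R[i]) : homspace H -> R[i] :=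
  fun p => fiber_integral eta f (repr p).

End functions.

Arguments Cc {R} X.
Arguments Cc_inv {R G} L H.

(* Main.v *)
Require Import Defs.
From mathcomp Require Import all_boot all_order all_algebra.
From mathcomp Require Import all_classical all_reals all_analysis.
From mathcomp Require Import complex.
Import numFieldNormedType.Exports.

(** On the functions of [Cc_inv L H] the integrand of the Radon transform at
    [x] does not move: [f (x h L) = f (x L)] for every [h] in [H].  As [eta]
    has total mass 1, [fiber_integral eta f x] is therefore just [f (x L)],
    and the transform is the descent of [f] from [G/L] to [G/H], with inverse
    the pullback along [coset_proj H L].  Well-definedness, linearity,
    injectivity and the last identity all follow from this.

    What remains is topological.  Since [lcoset M] is an open quotient map
    ([lcoset_nbhs]), continuity can be tested on [G].  The support of the
    transform of [f] lies in the image of the support of [f]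
    ([closure_sub_coset_proj]), a compact set; and the support of the pullback
    of [phi] lies in the preimage of the support of [phi], which is compact
    because [coset_proj H L] is proper when [H] is compact
    ([coset_proj_proper]). *)

Local Open Scope classical_set_scope.
Local Open Scope ring_scope.

(** * The topology of homogeneous spaces *)

Section homspace_topology.
Local Open Scope group_scope.
Context {G : topGroupType}.
Implicit Types M H L : groupClosed G.

Lemma lcosetMr M (x h : G) : h \in M -> lcoset M (x * h) = lcoset M x.
Proof. by move=> hM; apply/lcosetP; rewrite invgM -mulgA mulVg mulg1 gpredV. Qed.

Lemma lcoset_continuous M : continuous (lcoset M).
Proof. by apply/continuousP => A oA; exact: oA. Qed.

Lemma continuous_lcoset M (T : topologicalType) (f : homspace M -> T) :
  continuous (f \o lcoset M) -> continuous f.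
Proof. by move=> /continuousP cf; apply/continuousP => A /cf oA; exact: oA. Qed.

Lemma mulg_continuousr (h : G) : continuous (fun x : G => x * h).
Proof.
move=> x.
apply: (@continuous_comp _ _ _ (fun x : G => (x, h))
  (fun z : G * G => z.1 * z.2)).
  by apply: cvg_pair => /=; [exact: cvg_id|exact: cvg_cst].
exact: mulg_continuous.
Qed.

(** Quotient maps need not be open; here the saturation of an open set [U] is
    the union of its right translates by the elements of [M]. *)
Lemma lcoset_open M (U : set G) : open U -> open (lcoset M @` U).
Proof.
move=> oU.
(* By definition of the quotient topology. *)
have -> : open (lcoset M @` U) = open (lcoset M @^-1` (lcoset M @` U)) by [].
have -> : lcoset M @^-1` (lcoset M @` U) =
          \bigcup_(h in [set` M]) ((fun x : G => x * h) @^-1` U).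
  apply/seteqP; split=> [x /= [u Uu /esym/lcosetP xu]|x [h /= hM Uxh]].
    by exists (x^-1 * u) => //=; rewrite mulVKg.
  by exists (x * h) => //; exact: lcosetMr.
apply: bigcup_open => h _.
by move/continuousP: (mulg_continuousr h); apply.
Qed.

Lemma lcoset_nbhs M (x : G) (U : set G) :
  nbhs x U -> nbhs (lcoset M x) (lcoset M @` U).
Proof.
rewrite nbhsE => -[V [oV Vx] VU].
apply: (@filterS _ _ _ (lcoset M @` V)); first exact: image_subset.
by apply: open_nbhs_nbhs; split; [exact: lcoset_open|exists x].
Qed.

Lemma coset_proj_continuous H L : {subset L <= H} ->
  continuous (coset_proj H L).
Proof.
move=> LH; apply: continuous_lcoset.
rewrite (_ : _ \o _ = lcoset H); first exact: lcoset_continuous.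
by apply/funext => x /=; exact: coset_projE.
Qed.

(** If [xH] is adherent to [B] then [xL] is adherent to [A], because the image
    in [G/H] of a neighborhood of [xL] is a neighborhood of [xH].  This bounds
    the support of a function on [G/H] by the support of its pullback. *)
Lemma closure_sub_coset_proj H L (A : set (homspace L)) (B : set (homspace H)) :
  {subset L <= H} ->
  (forall x, B (lcoset H x) -> A (lcoset L x)) ->
  closure B `<=` coset_proj H L @` closure A.
Proof.
move=> LH BA p; rewrite -(lcoset_repr p); set x := repr p => clp.
exists (lcoset L x); last exact: coset_projE.
move=> V /(@lcoset_continuous L x) /= /(@lcoset_nbhs H) /clp.
move=> [z [Bz [y Vy yz]]]; exists (lcoset L y); split=> //.
by apply: BA; rewrite yz.
Qed.

(** A double tube argument, on covers by properties [P i] that hold eventually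
    in [i]: compactness of [H] makes the local validity near each [x h L]
    uniform in [h], hence valid on the preimage of a neighborhood of [x H];
    compactness of [K] then makes it uniform on the whole preimage of [K]. *)
Lemma coset_proj_proper H L (K : set (homspace H)) : {subset L <= H} ->
  compact [set` H] -> compact K -> compact (coset_proj H L @^-1` K).
Proof.
move=> LH /compact_near_coveringP cH /compact_near_coveringP cK.
apply/compact_near_coveringP => I F P FF cover.
suff : \forall i \near F, K `<=`
    (fun p => forall x, lcoset H x = p -> P i (lcoset L x)).
  apply: filterS => i Ki q; rewrite -(lcoset_repr q) /= => /Ki; apply.
  by rewrite coset_projE.
apply: cK => p; rewrite -(lcoset_repr p); set x := repr p => Kp.
have : \forall xi \near filter_prod (nbhs x) F, [set` H] `<=`
    (fun h : G => P xi.2 (lcoset L (xi.1 * h))).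
  apply: cH => h hH.
  have Kxh : (coset_proj H L @^-1` K) (lcoset L (x * h)).
    by rewrite /= coset_projE// lcosetMr.
  have [[A B] /= [Axh FB] AB] := cover _ Kxh.
  have cxh : (fun z : G * G => lcoset L (z.1 * z.2)) @ (x, h) -->
             lcoset L (x * h).
    by apply: continuous_comp; [exact: mulg_continuous|exact: lcoset_continuous].
  have [[U V] /= [Ux Vh] UV] := cxh _ Axh.
  exists (V, U `*` B) => /=; first by split=> //; exists (U, B).
  move=> [h' [x' i]] /= [Vh' [Ux' Bi]].
  by apply: (AB (_, i)); split=> //; exact: (UV (x', h')).
move=> [[U V] /= [Ux FV] UV].
exists (lcoset H @` U, V) => /=; first by split=> //; exact: lcoset_nbhs.
move=> [_ i] /= [[y Uy <-] Vi] z /esym/lcosetP zy.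
by rewrite -(mulVKg y z); apply: (UV (y, i)).
Qed.

End homspace_topology.

(** * The Radon transform of invariant functions *)

Section radon.
Context {R : realType} {G : topGroupType} {H L : groupClosed G}.
Context (eta : {measure set (borel (homspace (trace_subgroup H L))) -> \bar R})
  (eta1 : eta setT = 1%E).
Implicit Types f : homspace L -> R[i].

(** The integrand is constant and [eta] has mass 1. *)
Lemma fiber_integral_inv f (x : G) :
  (forall x h, h \in H -> f (lcoset L (x * h)%g) = f (lcoset L x)) ->
  fiber_integral eta f x = f (lcoset L x).
Proof.
move=> fH; rewrite /fiber_integral.
have -> : (fun q => f (ltrans x (@coset_incl G H L q))) =
          cst (f (lcoset L x)).
  by apply/funext => q; rewrite /coset_incl ltransE fH// subgroup_valP.
rewrite /cintegral !Rintegral_cst// eta1 /= !GRing.mulr1.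
by case: (f _).
Qed.

Lemma radon_transform_lcoset f (x : G) :
  (forall x h, h \in H -> f (lcoset L (x * h)%g) = f (lcoset L x)) ->
  radon_transform eta f (lcoset H x) = f (lcoset L x).
Proof.
move=> fH; rewrite /radon_transform fiber_integral_inv//.
have /esym/lcosetP xr := lcoset_repr (lcoset H x).
by rewrite -(mulVKg x (repr (lcoset H x))) fH.
Qed.

Context (subLH : {subset L <= H}).

Lemma radon_transform_Cc f : Cc_inv L H f ->
  Cc (homspace H) (radon_transform eta f).
Proof.
move=> [[cf sf] fH]; split.
  apply: continuous_lcoset.
  rewrite (_ : _ \o _ = f \o lcoset L); last first.
    by apply/funext => x /=; exact: radon_transform_lcoset.
  by move=> x; apply: continuous_comp; [exact: lcoset_continuous|exact: cf].
apply: (subclosed_compact (@closed_closure _ _) (B :=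
  coset_proj H L @` closure [set q | f q != 0])).
  apply: continuous_compact sf; apply: continuous_subspaceT.
  exact: coset_proj_continuous.
apply: closure_sub_coset_proj => // x /=.
by rewrite radon_transform_lcoset.
Qed.

Lemma coset_proj_inv (phi : homspace H -> R[i]) (x h : G) : h \in H ->
  (phi \o coset_proj H L) (lcoset L (x * h)%g) =
  (phi \o coset_proj H L) (lcoset L x).
Proof. by move=> hH /=; rewrite !coset_projE// lcosetMr. Qed.

Lemma coset_proj_Cc (phi : homspace H -> R[i]) : compact [set` H] ->
  Cc (homspace H) phi -> Cc_inv L H (phi \o coset_proj H L).
Proof.
move=> cH [cphi sphi]; split; last exact: coset_proj_inv.
have cp := coset_proj_continuous _ _ subLH; split.
  by move=> q; apply: continuous_comp; [exact: cp|exact: cphi].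
apply: (subclosed_compact (@closed_closure _ _) (B :=
  coset_proj H L @^-1` closure [set p | phi p != 0])).
  exact: coset_proj_proper.
have /closure_id -> :
    closed (coset_proj H L @^-1` closure [set p | phi p != 0]).
  by apply: preimage_closed; [move=> q _; exact: cp|exact: closed_closure].
by apply: closure_subset => q /= fq; exact: subset_closure.
Qed.

End radon.

Theorem theorem3p4 (R : realType) (G : topGroupType)
    (hausG : hausdorff_space G) (lcG : locally_compact [set: G])
    (H : groupClosed G) (cptH : compact [set` H])
    (dh : {measure set (borel (subgroup H)) -> \bar R})
    (haar_dh : left_haar_measure dh)
    (L : groupClosed G) (subLH : {subset L <= H})
    (closedL : closed [set` trace_subgroup H L])
    (dl : {measure set (borel (subgroup L)) -> \bar R})
    (haar_dl : left_haar_measure dl)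
    (sigma : {measure set (borel (homspace L)) -> \bar R})
    (radon_sigma : radon_measure sigma)
    (inv_sigma : translation_invariant L sigma)
    (eta : {measure set (borel (homspace (trace_subgroup H L))) -> \bar R})
    (radon_eta : radon_measure eta)
    (inv_eta : translation_invariant predT eta)
    (eta1 : eta setT = 1%E) :
  [/\ forall f : homspace L -> R[i], Cc_inv L H f -> forall x : G,
        radon_transform eta f (lcoset H x) = fiber_integral eta f x,
      forall (a : R[i]) (f g : homspace L -> R[i]),
        Cc_inv L H f -> Cc_inv L H g ->
        radon_transform eta (fun q => a * f q + g q) =
        (fun p => a * radon_transform eta f p + radon_transform eta g p),
      set_bij (Cc_inv L H) (Cc (homspace H)) (radon_transform eta)
    & forall f : homspace L -> R[i], Cc_inv L H f ->
        radon_transform eta f \o coset_proj H L = f].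
Proof.
have RE f x : Cc_inv L H f ->
    radon_transform eta f (lcoset H x) = f (lcoset L x).
  by move=> [_ fH]; exact: radon_transform_lcoset.
split.
- by move=> f Cf x; rewrite RE// fiber_integral_inv//; exact: Cf.2.
- move=> a f g Cf Cg; apply/funext => p.
  rewrite -(lcoset_repr p) (RE f)// (RE g)//.
  apply: radon_transform_lcoset => // x h hH.
  by rewrite Cf.2// Cg.2.
- split.
  + by move=> f Cf; exact: radon_transform_Cc.
  + move=> f g /set_mem Cf /set_mem Cg fg; apply/funext => q.
    by rewrite -(lcoset_repr q) -!RE// fg.
  + move=> phi Cphi; exists (phi \o coset_proj H L).
      exact: coset_proj_Cc.
    apply/funext => p; rewrite -(lcoset_repr p) RE/= ?coset_projE//.
    exact: coset_proj_Cc.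
- move=> f Cf; apply/funext => q; rewrite -(lcoset_repr q) /=.
  by rewrite coset_projE// RE.
Qed.
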